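(* Consider the multi-stage stochastic waste collection model $\mathcal{M}$ (described in the context), with optimal expected profit $z^*$, and let $z^{RH,W}$ be the objective value produced by the rolling horizon approach with $W$ consecutive periods. If $C=0$, then $$\frac{z^{RH,W}}{z^{*}}=1$$ for every choice of $W=1,\ldots,T-2$.
   Context: **Index sets.** Let $N\ge 1$ and $T\ge 2$ be integers; $\mathcal{I}=\{0,1,\ldots,N\}$ ($0$ is the depot, the others are waste bins), $\mathcal{I}'=\{1,\ldots,N\}$, $\mathcal{T}=\{1,\ldots,T\}$ (stages), $\mathcal{T}'=\{1,\ldots,T-1\}$, $\mathcal{T}''=\{2,\ldots,T\}$. **Scenario tree.** For each $t\in\mathcal{T}$ there is a finite nonempty set $\mathcal{N}^t$ of nodes at stage $t$ (nodes at different stages are regarded as distinct); $\mathcal{N}^1$ consists of the root only, and the nodes of $\mathcal{N}^T$ are the leaves. Each $n\in\mathcal{N}^t$, $t\in\mathcal{T}''$, has a unique parent $pa(n)\in\mathcal{N}^{t-1}$. Each node $n$ has a probability $\pi^n$, with $\sum_{n\in\mathcal{N}^t}\pi^n=1$ for each $t$ (and the probability of a non-leaf node is the sum of the probabilities of its children). **Parameters.** $C\ge 0$: travelling cost per distance unit; $R\ge 0$: unit selling price of waste; $Q$: vehicle capacity; $B$: waste density; $M$: Big-M number, i.e. a suitable large constant; $d_{ij}$: distance from $i$ to $j$ ($i,j\in\mathcal{I}$); $E_i$: capacity of bin $i\in\mathcal{I}'$; $S_i^{init}$: fraction of the volume of bin $i$ filled with waste at stage $1$; $a_i^n\in[0,1]$: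 accumulation rate (fraction of the volume) of bin $i\in\mathcal{I}'$ at node $n\in\mathcal{N}^t$, $t\in\mathcal{T}''$. **Decision variables.** $x_{ij}^t\in\{0,1\}$ ($i,j\in\mathcal{I}$, $i\ne j$, $t\in\mathcal{T}'$; arc $(i,j)$ is traversed at time $t+1$); $y_i^t\in\{0,1\}$ ($i\in\mathcal{I}'$, $t\in\mathcal{T}'$; bin $i$ is visited at time $t+1$); $f_{ij}^n\ge 0$ ($i\in\mathcal{I}'$, $j\in\mathcal{I}$, $i\ne j$, $n\in\mathcal{N}^t$, $t\in\mathcal{T}''$; waste flow); $w_i^n\ge 0$ ($i\in\mathcal{I}'$, $n\in\mathcal{N}^t$, $t\in\mathcal{T}''$; waste collected); $u_i^n\ge 0$ ($i\in\mathcal{I}'$, $n\in\mathcal{N}^t$, $t\in\mathcal{T}$; waste in the bin). **Model $\mathcal{M}$.** Maximize $$R\sum_{t\in\mathcal{T}''}\sum_{n\in\mathcal{N}^t}\pi^n\sum_{i\in\mathcal{I}'}w_i^n-C\sum_{t\in\mathcal{T}'}\sum_{i,j\in\mathcal{I},\,i\ne j}d_{ij}x_{ij}^t$$ subject to the following constraints. For all $n\in\mathcal{N}^t$, $t\in\mathcal{T}''$: - $\sum_{j\in\mathcal{I},j\ne i}f_{ij}^n-\sum_{j\in\mathcal{I}',j\ne i}f_{ji}^n=w_i^n$ for $i\in\mathcal{I}'$; - $f_{ij}^n\le (Q-E_jBa_j^n)x_{ij}^{t-1}$ for $i,j\in\mathcal{I}'$, $i\ne j$; - $f_{i0}^n\le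 Qx_{i0}^{t-1}$ for $i\in\mathcal{I}'$; - $f_{ij}^n\le Q-w_j^n$ for $i,j\in\mathcal{I}'$, $i\ne j$; - $f_{ij}^n\ge w_i^n-M(1-x_{ij}^{t-1})$ for $i\in\mathcal{I}'$, $j\in\mathcal{I}$, $i\ne j$; - $w_i^n\le E_iBy_i^{t-1}$ for $i\in\mathcal{I}'$; - $u_i^n\le M(1-y_i^{t-1})$ for $i\in\mathcal{I}'$; - $u_i^n=u_i^{pa(n)}+E_iBa_i^n-w_i^n$ for $i\in\mathcal{I}'$; - $u_i^{pa(n)}\le(1-a_i^n)E_iB$ for $i\in\mathcal{I}'$. For all $t\in\mathcal{T}'$: - $\sum_{j\in\mathcal{I},j\ne i}x_{ij}^t=y_i^t$ for $i\in\mathcal{I}'$; - $\sum_{i\in\mathcal{I},i\ne j}x_{ij}^t=y_j^t$ for $j\in\mathcal{I}'$; - $\sum_{i\in\mathcal{I}'}x_{i0}^t=\sum_{j\in\mathcal{I}'}x_{0j}^t$. At the root $n\in\mathcal{N}^1$: $u_i^n=E_iBS_i^{init}$ for $i\in\mathcal{I}'$. The binary and nonnegativity restrictions are as listed with the variables. The optimal value (optimal expected profit) of model $\mathcal{M}$ is denoted $z^*$. **Rolling horizon approach.** Fix an integer $W$ with $1\le W<T-1$. For $k=1,2,\ldots,T-1$ in this order, put $l=\min(k+W,T)$ and solve to optimality the subproblem on stages $k,\ldots,l$: it is model $\mathcal{M}$ restricted to these stages, i.e. with variables $x^t,y^t$ for $t=k,\ldots,l-1$ and $f^n,w^n,u^n$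 for nodes at stages $k+1,\ldots,l$, objective consisting of the revenue terms of stages $k+1,\ldots,l$ minus the travelling cost terms of $t=k,\ldots,l-1$, the same constraints for these stages, and with the inventory levels $u_i^n$, $n\in\mathcal{N}^k$, fixed: to $E_iBS_i^{init}$ if $k=1$, and to the values stored at the previous iteration if $k\ge 2$. From the optimal solution found, store $x_{ij}^k$, $y_i^k$ and $w_i^n,u_i^n$ for $n\in\mathcal{N}^{k+1}$. After the $T-1$ subproblems have been solved, $z^{RH,W}$ is the value of the objective function of $\mathcal{M}$ at the stored $x_{ij}^t$ ($t\in\mathcal{T}'$) and $w_i^n$ ($n\in\mathcal{N}^t$, $t\in\mathcal{T}''$). If one of the subproblems is infeasible, $z^{RH,W}=-\infty$. No rule is prescribed for selecting among multiple optimal solutions of a subproblem; the value $z^{RH,W}$ refers to any such selection.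
   Formalization: All node probabilities are assumed strictly positive, since with zero-probability nodes an optimal subproblem solution may make a later subproblem infeasible; the model is also assumed feasible with nonzero optimal profit, so that the ratio is defined. *)

(* Defs.v *)
From HB Require Import structures.
From mathcomp Require Import all_boot all_order all_algebra.
From mathcomp Require Import classical_sets reals ereal.

Set Implicit Arguments.
Unset Strict Implicit.
Unset Printing Implicit Defensive.

Import Order.TTheory GRing.Theory Num.Theory.
Local Open Scope classical_set_scope.
Local Open Scope ring_scope.

(* The sets N^t are the fibres of [stage]; [parent] is meaningful only for
   nodes of stage at least 2, and its value at the root is irrelevant.
   Nodes have positive probability: zero-probability nodes, which do not
   influence the objective but do influence feasibility, are excluded. *)
Record scenario_tree (R : realType) (T : nat) := ScenarioTree {
  node : finType;
  stage : node -> nat;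
  parent : node -> node;
  prob : node -> R;
  stage_bounds : forall n, (1 <= stage n <= T)%N;
  stage_inhabited : forall t, (1 <= t <= T)%N -> exists n, stage n = t;
  single_root : forall n m, stage n = 1%N -> stage m = 1%N -> n = m;
  stage_parent : forall n, (1 < stage n)%N -> stage n = (stage (parent n)).+1;
  prob_gt0 : forall n, 0 < prob n;
  prob_sum1 : forall t, (1 <= t <= T)%N -> \sum_(n | stage n == t) prob n = 1;
  prob_children : forall n, (stage n < T)%N ->
    prob n = \sum_(m | (1 < stage m)%N && (parent m == n)) prob m
}.

(* Locations are 'I_N.+1, with [ord0] the depot and every [i != ord0] a bin.
   Data indexed by bins are irrelevant at [ord0]. *)
Record instance (R : realType) (N T : nat) := Instance {
  tree : scenario_tree R T;
  travel_cost : R;                               (* C *)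
  price : R;                                     (* R *)
  vehicle_cap : R;                               (* Q *)
  density : R;                                   (* B *)
  bigM : R;                                      (* M *)
  dist : 'I_N.+1 -> 'I_N.+1 -> R;                (* d_ij *)
  bin_cap : 'I_N.+1 -> R;                        (* E_i *)
  init_fill : 'I_N.+1 -> R;                      (* S_i^init *)
  rate : node tree -> 'I_N.+1 -> R;              (* a_i^n *)
  travel_cost_ge0 : 0 <= travel_cost;
  price_ge0 : 0 <= price;
  vehicle_cap_ge0 : 0 <= vehicle_cap;
  density_ge0 : 0 <= density;
  dist_ge0 : forall i j, 0 <= dist i j;
  bin_cap_ge0 : forall i, i != ord0 -> 0 <= bin_cap i;
  init_fill_bounds : forall i, i != ord0 -> 0 <= init_fill i <= 1;
  rate_bounds : forall n i, (1 < stage n)%N -> i != ord0 -> 0 <= rate n i <= 1;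
  (* This makes the big-M constraints redundant when they are switched off:
     both w_i^n and u_i^n are at most E_i B in every feasible solution. *)
  bigM_large : forall i, i != ord0 -> bin_cap i * density <= bigM
}.

(* Components with indices outside the range of the corresponding variable
   (such as [uses_arc t i i]) are left unconstrained and never enter an objective. *)
Record decision (R : realType) (N T : nat) (P : instance R N T) := Decision {
  uses_arc : nat -> 'I_N.+1 -> 'I_N.+1 -> bool;                 (* x_ij^t *)
  visit : nat -> 'I_N.+1 -> bool;                          (* y_i^t *)
  flow : node (tree P) -> 'I_N.+1 -> 'I_N.+1 -> R;         (* f_ij^n *)
  collected : node (tree P) -> 'I_N.+1 -> R;               (* w_i^n *)
  level : node (tree P) -> 'I_N.+1 -> R                    (* u_i^n *)
}.

Record node_constraints (R : realType) (N T : nat) (P : instance R N T)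
    (s : decision P) (n : node (tree P)) : Prop := NodeConstraints {
  flow_balance : forall i, i != ord0 ->
    \sum_(j | j != i) flow s n i j
    - \sum_(j | (j != ord0) && (j != i)) flow s n j i = collected s n i;
  flow_bins_cap : forall i j, i != ord0 -> j != ord0 -> i != j ->
    flow s n i j <= (vehicle_cap P - bin_cap P j * density P * rate n j)
                    * (uses_arc s (stage n).-1 i j)%:R;
  flow_depot_cap : forall i, i != ord0 ->
    flow s n i ord0 <= vehicle_cap P * (uses_arc s (stage n).-1 i ord0)%:R;
  flow_room : forall i j, i != ord0 -> j != ord0 -> i != j ->
    flow s n i j <= vehicle_cap P - collected s n j;
  flow_lower : forall i j, i != ord0 -> i != j ->
    flow s n i j >=
      collected s n i - bigM P * (1 - (uses_arc s (stage n).-1 i j)%:R);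
  collected_visit : forall i, i != ord0 ->
    collected s n i <= bin_cap P i * density P * (visit s (stage n).-1 i)%:R;
  level_visit : forall i, i != ord0 ->
    level s n i <= bigM P * (1 - (visit s (stage n).-1 i)%:R);
  level_balance : forall i, i != ord0 ->
    level s n i = level s (parent n) i
      + bin_cap P i * density P * rate n i - collected s n i;
  level_overflow : forall i, i != ord0 ->
    level s (parent n) i <= (1 - rate n i) * bin_cap P i * density P;
  flow_ge0 : forall i j, i != ord0 -> i != j -> 0 <= flow s n i j;
  collected_ge0 : forall i, i != ord0 -> 0 <= collected s n i
}.

Record routing_constraints (R : realType) (N T : nat) (P : instance R N T)
    (s : decision P) (t : nat) : Prop := RoutingConstraints {
  arc_out : forall i, i != ord0 ->
    (\sum_(j | j != i) uses_arc s t i j)%N = visit s t i;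
  arc_in : forall j, j != ord0 ->
    (\sum_(i | i != j) uses_arc s t i j)%N = visit s t j;
  arc_depot :
    (\sum_(i | i != ord0) uses_arc s t i ord0)%N
    = (\sum_(j | j != ord0) uses_arc s t ord0 j)%N
}.

(* The model restricted to the stages k, ..., l, with the inventory levels at
   the nodes of stage k fixed to the values given by [u0]. *)
Record horizon_feasible (R : realType) (N T : nat) (P : instance R N T)
    (k l : nat) (u0 : node (tree P) -> 'I_N.+1 -> R) (s : decision P) : Prop :=
  HorizonFeasible {
  horizon_nodes : forall n, (k < stage n <= l)%N -> node_constraints s n;
  horizon_routing : forall t, (k <= t < l)%N -> routing_constraints s t;
  horizon_start : forall n i, stage n = k -> i != ord0 -> level s n i = u0 n i;
  horizon_level_ge0 : forall n i, (k <= stage n <= l)%N -> i != ord0 ->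
    0 <= level s n i
}.

Definition horizon_profit (R : realType) (N T : nat) (P : instance R N T)
    (k l : nat) (s : decision P) : R :=
  price P * (\sum_(k.+1 <= t < l.+1) \sum_(n | stage n == t)
               prob n * \sum_(i | i != ord0) collected s n i)
  - travel_cost P * (\sum_(k <= t < l) \sum_i \sum_(j | i != j)
                       dist P i j * (uses_arc s t i j)%:R).

Definition horizon_optimal (R : realType) (N T : nat) (P : instance R N T)
    (k l : nat) (u0 : node (tree P) -> 'I_N.+1 -> R) (s : decision P) : Prop :=
  horizon_feasible k l u0 s /\
  forall s', horizon_feasible k l u0 s' ->
    horizon_profit k l s' <= horizon_profit k l s.

Definition initial_level (R : realType) (N T : nat) (P : instance R N T)
    (n : node (tree P)) (i : 'I_N.+1) : R :=
  bin_cap P i * density P * init_fill P i.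

Definition feasible (R : realType) (N T : nat) (P : instance R N T)
    (s : decision P) : Prop :=
  horizon_feasible 1 T (@initial_level R N T P) s.

Definition profit (R : realType) (N T : nat) (P : instance R N T)
    (s : decision P) : R :=
  horizon_profit 1 T s.

(* z^*, equal to -oo when the model is infeasible *)
Definition optimal_profit (R : realType) (N T : nat) (P : instance R N T) :
    \bar R :=
  ereal_sup [set (profit s)%:E | s in [set s : decision P | feasible s]].

(* In a run of the rolling horizon approach, [sol k] is the optimal solution
   found at iteration k. The levels at stage k that are stored at iteration
   k - 1 are those of [sol k.-1]. *)
Definition rh_level (R : realType) (N T : nat) (P : instance R N T)
    (sol : nat -> decision P) (k : nat) : node (tree P) -> 'I_N.+1 -> R :=
  if k == 1%N then @initial_level R N T P else level (sol k.-1).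

Definition rh_solved (R : realType) (N T : nat) (P : instance R N T)
    (W : nat) (sol : nat -> decision P) (k : nat) : Prop :=
  horizon_optimal k (minn (k + W) T) (rh_level sol k) (sol k).

(* The stored values: iteration k provides x^k, y^k and the recourse variables
   of the nodes of stage k + 1. *)
Definition rh_stored (R : realType) (N T : nat) (P : instance R N T)
    (sol : nat -> decision P) : decision P :=
  Decision
    (fun t => uses_arc (sol t) t)
    (fun t => visit (sol t) t)
    (fun n => flow (sol (stage n).-1) n)
    (fun n => collected (sol (stage n).-1) n)
    (fun n => if stage n == 1%N then @initial_level R N T P n
              else level (sol (stage n).-1) n).

(* [rh_value P W z]: some run of the rolling horizon approach, with some
   selection among the optimal solutions of each subproblem, yields
   z^{RH,W} = z. *)
Inductive rh_value (R : realType) (N T : nat) (P : instance R N T) (W : nat) :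
    \bar R -> Prop :=
| rh_completed (sol : nat -> decision P) :
    (forall k, (1 <= k < T)%N -> rh_solved W sol k) ->
    rh_value P W (profit (rh_stored sol))%:E
| rh_infeasible (sol : nat -> decision P) (k : nat) :
    (1 <= k < T)%N ->
    (forall j, (1 <= j < k)%N -> rh_solved W sol j) ->
    (forall s, ~ horizon_feasible k (minn (k + W) T) (rh_level sol k) s) ->
    rh_value P W -oo%E.

(* Main.v *)
(** Every bin can be served by a round trip of its own, so without travelling
    costs the bins decouple. A visited bin is emptied at all nodes of the stage,
    which is possible exactly when its content never exceeds the vehicle
    capacity there. Emptying each bin at every stage where this is possible gives
    the pointwise least levels among all feasible solutions. As the waste
    collected is the initial waste plus the accumulated waste minus the final
    levels, maximizing the profit over a horizon means minimizing the expected
    levels at its last stage. A subproblem of the rolling horizon approach can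
    follow the plan of the previous one and then the greedy policy, so by
    induction each subproblem is feasible and its optimal solutions attain the
    least levels at the end of its horizon; the last horizon ends at stage T. *)
Require Import Defs.
From mathcomp Require Import all_boot all_order all_algebra.
From mathcomp Require Import classical_sets reals ereal.
From mathcomp Require Import zify lra.

Set Implicit Arguments.
Unset Strict Implicit.
Unset Printing Implicit Defensive.

Import Order.TTheory GRing.Theory Num.Theory.
Local Open Scope ring_scope.

(** * Greedy levels, their minimality, and greedy continuation of a plan *)

Section GreedyPolicy.
Variables (R : realType) (N T : nat) (P : instance R N T).
Implicit Types (s : decision P) (n m : node (tree P)) (i j : 'I_N.+1).
Implicit Types (u : node (tree P) -> 'I_N.+1 -> R).

Definition inflow n i : R := bin_cap P i * density P * rate n i.

Lemma inflow_ge0 n i : (1 < stage n)%N -> i != ord0 -> 0 <= inflow n i.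
Proof.
move=> n1 i0; have /andP[a0 _] := rate_bounds n1 i0.
by rewrite !mulr_ge0 ?bin_cap_ge0 ?density_ge0.
Qed.

(* Levels at the nodes of stage [t.+1]. *)
Fixpoint greedy_level_at (t : nat) n i : R :=
  if t isn't t'.+1 then initial_level n i else
  if [forall m, (stage m == t.+1) ==>
        (greedy_level_at t' (parent m) i + inflow m i <= vehicle_cap P)]
  then 0 else greedy_level_at t' (parent n) i + inflow n i.

Definition greedy_level n i : R := greedy_level_at (stage n).-1 n i.

(** The test ranges over all nodes of a stage because visits are decided per stage, before the
    scenario is revealed. *)
Definition greedy_visit (t : nat) i : bool :=
  [forall m : node (tree P), (stage m == t.+1) ==>
     (greedy_level (parent m) i + inflow m i <= vehicle_cap P)].

Lemma greedy_level_root n i : stage n = 1%N ->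
  greedy_level n i = initial_level n i.
Proof. by rewrite /greedy_level => ->. Qed.

Lemma greedy_levelS n i : (1 < stage n)%N ->
  greedy_level n i = if greedy_visit (stage n).-1 i then 0
                     else greedy_level (parent n) i + inflow n i.
Proof.
move=> n1; have pn := stage_parent n1.
have p1 : (0 < stage (parent n))%N by lia.
rewrite /greedy_level pn /= -(prednK p1) /=.
congr (if _ then _ else _); apply: eq_forallb => m.
apply: implyb_id2l => /eqP mE.
(* Parents of nodes of equal stage have equal stage, so their levels unfold to the same recursion
   depth. *)
suff -> : greedy_level (parent m) i
        = greedy_level_at (stage (parent n)).-1 (parent m) i by [].
by rewrite /greedy_level; have := @stage_parent _ _ _ m; rewrite mE => /(_ isT) [<-].
Qed.

Definition greedy_collected n i : R :=
  if greedy_visit (stage n).-1 i then greedy_level (parent n) i + inflow n i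
  else 0.

(** Waste collected at a bin leaves it along its outgoing arcs; each carries at most the vehicle
    capacity times its indicator, and the indicators sum to [visit]. *)
Lemma collected_le_cap s n i : (1 < stage n)%N -> i != ord0 ->
  node_constraints s n -> routing_constraints s (stage n).-1 ->
  collected s n i <= vehicle_cap P * (visit s (stage n).-1 i)%:R.
Proof.
move=> n1 i0 hn hr; rewrite -(flow_balance hn i0) -(arc_out hr i0).
have fin0 : 0 <= \sum_(j | (j != ord0) && (j != i)) flow s n j i.
  by apply: sumr_ge0 => j /andP[j0 ji]; apply: (flow_ge0 hn).
apply: (le_trans (y := \sum_(j | j != i) flow s n i j)); first by lra.
rewrite natr_sum mulr_sumr; apply: ler_sum => j ji.
have [->|j0] := eqVneq j ord0; first exact: (flow_depot_cap hn).
rewrite eq_sym in ji; apply: le_trans (flow_bins_cap hn i0 j0 ji) _.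
apply: ler_wpM2r => //; have := inflow_ge0 n1 j0.
by rewrite /inflow; lra.
Qed.

(** Induction on the stage. If the greedy policy skips a bin, its content exceeds the capacity at
    some node [m]; by induction the content under [s] does too, so [s] cannot visit the bin
    either. *)
Lemma greedy_level_le k l u s : (0 < k)%N -> horizon_feasible k l u s ->
  (forall n i, stage n = k -> i != ord0 -> greedy_level n i <= u n i) ->
  forall n i, (k <= stage n <= l)%N -> i != ord0 ->
    greedy_level n i <= level s n i.
Proof.
move=> k0 hs hu n i; move En: (stage n) => t; elim: t n En => [|t IH] n En; first lia.
move=> /andP[kt tl] i0; have [Ek|kt'] : k = t.+1 \/ (k <= t)%N by lia.
  by rewrite (horizon_start hs) ?hu ?En.
have tr := horizon_routing hs (t := t); rewrite kt' tl in tr.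
have {tr} := tr isT => tr.
have hc m : stage m = t.+1 -> node_constraints s m.
  by move=> Em; apply: (horizon_nodes hs); rewrite Em; lia.
have hp m : stage m = t.+1 -> greedy_level (parent m) i <= level s (parent m) i.
  move=> Em; have := @stage_parent _ _ _ m; rewrite Em => /(_ ltac:(lia)) [Et].
  by apply: IH => //; lia.
have n0 : 0 <= level s n i by apply: (horizon_level_ge0 hs) => //; lia.
have n1 : (1 < stage n)%N by lia.
rewrite greedy_levelS // En /=.
case: ifPn => // /forallPn /= [m]; rewrite negb_imply -ltNge => /andP[/eqP Em hQ].
(* A visit would force level 0 at [m], hence a collection there above the vehicle capacity. *)
have vt : visit s t i = false.
  apply/negP => vt; have m1 : (1 < stage m)%N by lia.
  have := collected_le_cap m1 i0 (hc _ Em); rewrite Em /= vt mulr1 => /(_ tr).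
  have := level_visit (hc _ Em) i0; rewrite Em /= vt subrr mulr0.
  have := level_balance (hc _ Em) i0; rewrite -/(inflow m i).
  by have := hp _ Em; move: hQ; lra.
have := collected_visit (hc _ En) i0; rewrite En /= vt mulr0.
have := level_balance (hc _ En) i0; rewrite -/(inflow n i).
have := hp _ En; lra.
Qed.

(* The greedy part uses the round trips 0 -> i -> 0. *)
Definition greedy_after (l : nat) s : decision P := Decision
  (fun t i j => if (t < l)%N then uses_arc s t i j else
     if i == ord0 then greedy_visit t j else (j == ord0) && greedy_visit t i)
  (fun t i => if (t < l)%N then visit s t i else greedy_visit t i)
  (fun n i j => if (stage n <= l)%N then flow s n i j else
     if j == ord0 then greedy_collected n i else 0)
  (fun n i => if (stage n <= l)%N then collected s n i
              else greedy_collected n i)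
  (fun n i => if (stage n <= l)%N then level s n i else greedy_level n i).

Lemma greedy_after_prefix l s n : (1 < stage n <= l)%N ->
  node_constraints s n -> node_constraints (greedy_after l s) n.
Proof.
move=> /andP[n1 nl] [? ? ? ? ? ? ? ? ? ? ?].
have pl : ((stage n).-1 < l)%N by lia.
have pnl : (stage (parent n) <= l)%N by have := stage_parent n1; lia.
by split=> /=; rewrite ?nl ?pl ?pnl.
Qed.

Hypothesis feasibleP : exists s, feasible s.

Lemma greedy_level_ge0 n i : i != ord0 -> 0 <= greedy_level n i.
Proof.
move=> i0; move En: (stage n) => t; elim: t n En => [|t IH] n En.
  by have := stage_bounds n; lia.
have [n1|n1] := ltnP 1 (stage n).
  rewrite greedy_levelS //; case: ifP => // _; apply: addr_ge0.
    by apply: IH; have := stage_parent n1; lia.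
  exact: inflow_ge0.
rewrite greedy_level_root; last by lia.
have /andP[h _] := init_fill_bounds P i0.
by rewrite !mulr_ge0 ?bin_cap_ge0 ?density_ge0.
Qed.

(** Some feasible solution obeys this bound, and greedy levels lie below its levels. *)
Lemma greedy_level_overflow n i : (1 < stage n)%N -> i != ord0 ->
  greedy_level (parent n) i <= (1 - rate n i) * bin_cap P i * density P.
Proof.
move=> n1 i0; have [s hs] := feasibleP.
have /andP[_ nT] := stage_bounds n.
have pn := stage_parent n1.
have hn : node_constraints s n by apply: (horizon_nodes hs); lia.
apply: le_trans (level_overflow hn i0).
apply: (greedy_level_le _ hs) => //; last by lia.
by move=> m j m1 j0; rewrite greedy_level_root.
Qed.

Lemma greedy_after_suffix l s n : (1 < stage n)%N -> (l < stage n)%N ->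
  (forall m i, stage m = l -> i != ord0 -> level s m i = greedy_level m i) ->
  node_constraints (greedy_after l s) n.
Proof.
move=> n1 ln hl; have pn := stage_parent n1.
have nl : (stage n <= l)%N = false by lia.
have pl : ((stage n).-1 < l)%N = false by lia.
(* At the junction, where [n] has stage [l.+1], the parent still carries the level of [s], which
   [hl] identifies with the greedy one. *)
have lp i : i != ord0 ->
    level (greedy_after l s) (parent n) i = greedy_level (parent n) i.
  by move=> i0 /=; case: leqP => // h; apply: hl => //; lia.
have w0 i : i != ord0 -> 0 <= greedy_collected n i.
  move=> i0; rewrite /greedy_collected; case: ifP => // _.
  by rewrite addr_ge0 ?greedy_level_ge0 ?inflow_ge0.
have wE i : i != ord0 -> greedy_collected n i
    <= bin_cap P i * density P * (greedy_visit (stage n).-1 i)%:R.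
  move=> i0; rewrite /greedy_collected; case: ifP => _; last by rewrite mulr0.
  have := greedy_level_overflow n1 i0; rewrite /inflow; rewrite mulr1; lra.
have wQ i : i != ord0 -> greedy_collected n i
    <= vehicle_cap P * (greedy_visit (stage n).-1 i)%:R.
  move=> i0; rewrite /greedy_collected; case: ifP => [/forallP|_]; last by rewrite mulr0.
  move=> /(_ n); rewrite prednK ?eqxx /=; last by lia.
  by rewrite mulr1.
have wQ' i : i != ord0 -> greedy_collected n i <= vehicle_cap P.
  move=> i0; apply: le_trans (wQ i i0) _; case: greedy_visit; first by rewrite mulr1.
  by rewrite mulr0 vehicle_cap_ge0.
have wM i : i != ord0 -> greedy_collected n i <= bigM P.
  move=> i0; apply: le_trans (wE i i0) _; have := bigM_large P i0.
  have := mulr_ge0 (bin_cap_ge0 P i0) (density_ge0 P).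
  by case: greedy_visit; rewrite ?mulr1 ?mulr0; lra.
split; rewrite /greedy_after /= ?nl ?pl.
- move=> i i0; rewrite (bigD1 ord0) /=; last by rewrite eq_sym.
  rewrite (negPf i0) [X in _ - X]big1 // subr0.
  by rewrite big1 ?addr0 // => j /andP[_ /negPf ->].
- by move=> i j /negPf -> /negPf -> _ /=; rewrite mulr0.
- by move=> i i0; rewrite (negPf i0) wQ.
- by move=> i j i0 j0 _; rewrite (negPf j0) subr_ge0 wQ'.
(* Towards another bin both arc and flow vanish, so the bound reads w <= M; towards the depot the
   flow is the collected waste itself. *)
- move=> i j i0 ij; rewrite (negPf i0); case: eqP => /= _; last first.
    by have := wM i i0; lra.
  have := wM i i0; have := w0 i i0; rewrite /greedy_collected.
  by case: greedy_visit => /= ? ?; rewrite ?subrr ?subr0; lra.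
- exact: wE.
- move=> i i0; rewrite greedy_levelS // ; have := greedy_level_overflow n1 i0.
  case: ifP => _; first by rewrite subrr mulr0.
  have := bigM_large P i0; rewrite /inflow /=; lra.
- move=> i i0; have := lp i i0; rewrite /= => ->.
  rewrite -/(inflow n i) greedy_levelS // /greedy_collected.
  by case: ifP => _; lra.
- by move=> i i0; have := lp i i0; rewrite /= => ->; apply: greedy_level_overflow.
- by move=> i j i0 _; case: ifP => // _; apply: w0.
- exact: w0.
Qed.

Lemma greedy_after_routing l s t : (l <= t)%N ->
  routing_constraints (greedy_after l s) t.
Proof.
move=> lt; have tl : (t < l)%N = false by lia.
split; rewrite /greedy_after /= ?tl.
- move=> i i0; rewrite (bigD1 ord0) /=; last by rewrite eq_sym.
  rewrite (negPf i0) /= big1 ?addn0 // => j /andP[_ /negPf ->] //.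
- move=> j j0; rewrite (bigD1 ord0) /=; last by rewrite eq_sym.
  by rewrite (negPf j0) /= big1 ?addn0 // => i /andP[_ /negPf ->].
- by apply: eq_bigr => i /negPf ->.
Qed.

(** Moves the window from [k], [l] to [k'], [l']: the old plan is followed up to [l], the greedy
    policy afterwards. This supplies a candidate for the next subproblem. *)
Lemma greedy_after_feasible k l u s k' l' : (0 < k)%N ->
  horizon_feasible k l u s ->
  (forall m i, stage m = l -> i != ord0 -> level s m i = greedy_level m i) ->
  (k <= k' <= l)%N -> horizon_feasible k' l' (level s) (greedy_after l s).
Proof.
move=> k0 hs hl /andP[kk' k'l]; split.
- move=> n /andP[k'n nl']; have [nl|nl] := leqP (stage n) l.
    by apply: greedy_after_prefix; [lia | apply: (horizon_nodes hs); lia].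
  by apply: greedy_after_suffix => //; lia.
- move=> t /andP[k't tl']; have [tl|tl] := ltnP t l.
    have /(horizon_routing hs) [h1 h2 h3] : (k <= t < l)%N by lia.
    by split=> /=; rewrite tl.
  exact: greedy_after_routing.
- by move=> n i En i0 /=; rewrite En k'l.
- move=> n i kn i0 /=; case: leqP => nl; last exact: greedy_level_ge0.
  by apply: (horizon_level_ge0 hs) => //; lia.
Qed.

Lemma greedy_after_level l s n i : (l <= stage n)%N -> i != ord0 ->
  (forall m i, stage m = l -> i != ord0 -> level s m i = greedy_level m i) ->
  level (greedy_after l s) n i = greedy_level n i.
Proof. by move=> ln i0 hl /=; case: leqP => // nl; apply: hl => //; lia. Qed.

End GreedyPolicy.

(** * Profit in terms of expected final levels *)

Section Profit.
Variables (R : realType) (N T : nat) (P : instance R N T).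
Implicit Types (s : decision P) (n m : node (tree P)).
Implicit Types (u : node (tree P) -> 'I_N.+1 -> R).

Definition expected_total (t : nat) u : R :=
  \sum_(n | stage n == t) prob n * \sum_(i | i != ord0) u n i.

Lemma expected_total_eq t u u' :
  (forall n i, stage n = t -> i != ord0 -> u n i = u' n i) ->
  expected_total t u = expected_total t u'.
Proof.
move=> e; apply: eq_bigr => n /eqP En; congr (_ * _).
by apply: eq_bigr => i i0; apply: e.
Qed.

Lemma expected_totalD t u u' :
  expected_total t (fun n i => u n i + u' n i)
  = expected_total t u + expected_total t u'.
Proof.
rewrite -big_split /=; apply: eq_bigr => n _.
by rewrite big_split mulrDr.
Qed.

Lemma expected_totalN t u :
  expected_total t (fun n i => - u n i) = - expected_total t u.
Proof. by rewrite -sumrN; apply: eq_bigr => n _; rewrite sumrN mulrN. Qed.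

(** Group the nodes of stage [t.+1] by parent; the probabilities of the children add up to that of
    the parent. *)
Lemma expected_total_parent t u : (0 < t < T)%N ->
  expected_total t.+1 (fun n => u (parent n)) = expected_total t u.
Proof.
move=> /andP[t0 tT].
rewrite /expected_total (partition_big (@parent _ _ (tree P)) (fun m => stage m == t)) /=.
  apply: eq_bigr => m /eqP Em.
  rewrite prob_children ?Em // mulr_suml; apply: eq_big => [n|n /andP[_ /eqP ->] //].
  have [En|_] := eqVneq (parent n) m; rewrite ?andbT ?andbF //.
  apply/eqP/idP => [|n1]; first by lia.
  by have := stage_parent n1; rewrite En; lia.
by move=> n /eqP En; have := @stage_parent _ _ _ n; rewrite En; lia.
Qed.

(** Since all probabilities are positive, a sum of nonnegative gaps with zero expectation has only
    zero gaps. *)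
Lemma expected_total_le_eq t u u' :
  (forall n i, stage n = t -> i != ord0 -> u n i <= u' n i) ->
  expected_total t u' <= expected_total t u ->
  forall n i, stage n = t -> i != ord0 -> u n i = u' n i.
Proof.
move=> le le' n i /eqP En i0.
have d0 m j : stage m == t -> j != ord0 -> 0 <= u' m j - u m j.
  by move=> /eqP Em j0; rewrite subr_ge0 le.
have dn0 m : stage m == t -> 0 <= prob m * \sum_(j | j != ord0) (u' m j - u m j).
  move=> Em; apply: mulr_ge0; first exact/ltW/prob_gt0.
  by apply: sumr_ge0 => j; apply: d0.
have tot0 : expected_total t (fun n i => u' n i - u n i) == 0.
  rewrite eq_le expected_totalD expected_totalN subr_le0 le' /=.
  by rewrite -expected_totalN -expected_totalD; apply: sumr_ge0.
move: tot0; rewrite psumr_eq0 // => /allP /(_ n (mem_index_enum _)).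
rewrite En /= mulf_eq0 gt_eqF ?prob_gt0 //= psumr_eq0; last by move=> j; apply: d0.
move=> /allP /(_ i (mem_index_enum _)).
by rewrite i0 /= subr_eq0 => /eqP.
Qed.

(** Conservation of waste: the expected level balances telescope over the stages. *)
Lemma collected_expected_total k l u s : (0 < k <= l)%N -> (l <= T)%N ->
  horizon_feasible k l u s ->
  \sum_(k.+1 <= t < l.+1) expected_total t (collected s)
  = expected_total k u - expected_total l (level s)
    + \sum_(k.+1 <= t < l.+1) expected_total t (@inflow _ _ _ P).
Proof.
move=> /andP[k0 kl] lT hs.
rewrite -(expected_total_eq (u := level s) (t := k)); last first.
  by move=> n i En i0; apply: (horizon_start hs).
rewrite -opprB -(telescope_sumr (fun t => expected_total t (level s))) //.
rewrite -sumrN !big_add1 -big_split /=; apply: eq_big_nat => t /andP[kt tl].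
rewrite -(expected_total_parent (t := t)); last by lia.
rewrite -!(expected_totalN, expected_totalD); apply: expected_total_eq => n i En i0.
rewrite (level_balance (horizon_nodes hs (n := n) _)) ?En //; last by lia.
by rewrite /inflow; lra.
Qed.

(** Only revenue remains, and by conservation two plans with the same initial levels differ in it
    only through their final levels. *)
Lemma horizon_profit_le k l u s u' s' : travel_cost P = 0 -> 0 < price P ->
  (0 < k <= l)%N -> (l <= T)%N ->
  (forall n i, stage n = k -> i != ord0 -> u n i = u' n i) ->
  horizon_feasible k l u s -> horizon_feasible k l u' s' ->
  (horizon_profit k l s' <= horizon_profit k l s)
  = (expected_total l (level s) <= expected_total l (level s')).
Proof.
move=> C0 p0 kl lT uu' hs hs'; rewrite /horizon_profit C0 !mul0r !subr0 ler_pM2l //.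
have -> := collected_expected_total kl lT hs.
have -> := collected_expected_total kl lT hs'.
rewrite (expected_total_eq uu'); apply/idP/idP; lra.
Qed.

Lemma optimal_profit_attained s : feasible s ->
  (forall s', feasible s' -> profit s' <= profit s) ->
  optimal_profit P = (profit s)%:E.
Proof.
move=> fs ub; apply/eqP; rewrite eq_le; apply/andP; split.
  by apply: ge_ereal_sup => _ [s' fs' <-]; rewrite lee_fin ub.
by apply: ereal_sup_ubound; exists s.
Qed.

End Profit.

(** * Induction over the subproblems and optimality of the stored plan *)

Section RollingHorizon.
Variables (R : realType) (N T : nat) (P : instance R N T) (W : nat).
Hypotheses (C0 : travel_cost P = 0) (price0 : 0 < price P) (W0 : (0 < W)%N).
Hypothesis feasibleP : exists s : decision P, feasible s.
Implicit Types (s : decision P) (n : node (tree P)) (sol : nat -> decision P).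

(** One feasible [s'] ending at the greedy levels suffices: an optimal [s] has no larger expected
    final level, while greedy levels are pointwise lower bounds. Levels before stage [l] may still
    differ. *)
Lemma optimal_level u s s' k l : (0 < k <= l)%N -> (l <= T)%N ->
  (forall n i, stage n = k -> i != ord0 -> greedy_level n i <= u n i) ->
  horizon_optimal k l u s -> horizon_feasible k l u s' ->
  (forall n i, stage n = l -> i != ord0 -> level s' n i = greedy_level n i) ->
  forall n i, stage n = l -> i != ord0 -> level s n i = greedy_level n i.
Proof.
move=> kl lT hu [hs opt] hs' hl n i En i0; apply/esym.
apply: (expected_total_le_eq (t := l)) => // [m j Em j0|].
  by apply: (greedy_level_le _ hs) => //; lia.
rewrite -(expected_total_eq hl) -(horizon_profit_le C0 price0 kl lT _ hs hs') //.
exact: opt.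
Qed.

Lemma rh_levelS sol k : (0 < k)%N -> rh_level sol k.+1 = level (sol k).
Proof. by case: k. Qed.

(** The invariant asks for a candidate ending at the greedy levels, not mere feasibility: it forces
    the optimal [sol k] to end there too, so that [sol k] continued greedily is the next
    candidate. *)
Lemma rh_subproblem sol k : (1 <= k < T)%N ->
  (forall j, (1 <= j < k)%N -> rh_solved W sol j) ->
  (forall n i, stage n = k -> i != ord0 -> greedy_level n i <= rh_level sol k n i)
  /\ exists2 s, horizon_feasible k (minn (k + W) T) (rh_level sol k) s &
       forall n i, stage n = minn (k + W) T -> i != ord0 ->
         level s n i = greedy_level n i.
Proof.
elim: k => [|k IH] // kT solved; have [->|k0] := posnP k.
  split=> [n i En i0|]; first by rewrite greedy_level_root.
  have [s hs] := feasibleP.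
  have hl n i : stage n = 1%N -> i != ord0 -> level s n i = greedy_level n i.
    by move=> En i0; rewrite greedy_level_root // (horizon_start hs).
  (* On this one-stage window only root levels matter, so [greedy_after 1 s] is greedy from the
     start. *)
  have hs1 : horizon_feasible 1 1 (@initial_level _ _ _ P) s.
    split=> [n|t|n i En i0|n i En i0]; [lia|lia|exact: (horizon_start hs)|].
    by apply: (horizon_level_ge0 hs) => //; have := stage_bounds n; lia.
  exists (greedy_after 1 s); last by move=> n i En i0; apply: greedy_after_level => //; lia.
  have [h1 h2 h3 h4] := greedy_after_feasible feasibleP (minn (1 + W) T)
    (isT : (0 < 1)%N) hs1 hl (isT : (1 <= 1 <= 1)%N).
  split=> // n i En i0; rewrite h3 // hl // greedy_level_root //.
have [|j ? |hu [s hs hl]] := IH _ _; [lia|by apply: solved; lia|].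
have optk : rh_solved W sol k by apply: solved; lia.
have [hk _] := optk.
rewrite rh_levelS //; split=> [n i En i0|].
  by apply: (greedy_level_le _ hk) => //; lia.
have hkl : forall n i, stage n = minn (k + W) T -> i != ord0 ->
    level (sol k) n i = greedy_level n i.
  by apply: optimal_level hu optk hs hl; lia.
exists (greedy_after (minn (k + W) T) (sol k)).
  by apply: (greedy_after_feasible feasibleP _ k0 hk hkl); lia.
by move=> n i En i0; apply: greedy_after_level => //; lia.
Qed.

(** The constraints at a node come from the iteration that stored it. The only link to another
    iteration is the level of the parent, which is the fixed starting level. *)
Lemma rh_stored_feasible sol : (forall k, (1 <= k < T)%N -> rh_solved W sol k) ->
  feasible (rh_stored sol).
Proof.
move=> solved.
have hf k (kT : (1 <= k < T)%N) := (solved k kT).1.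
have stored_level n i : (1 < stage n)%N -> i != ord0 ->
    level (rh_stored sol) (parent n) i = level (sol (stage n).-1) (parent n) i.
  move=> n1 i0; have pn := stage_parent n1; have := stage_bounds n => nb.
  rewrite (horizon_start (hf (stage n).-1 _)) //=; [|lia|lia].
  rewrite pn /= /rh_level.
  by case: eqP.
split.
- move=> n /andP[n1 nT]; have hk : (1 <= (stage n).-1 < T)%N by lia.
  have hn : ((stage n).-1 < stage n <= minn ((stage n).-1 + W) T)%N by lia.
  have [h1 h2 h3 h4 h5 h6 h7 h8 h9 h10 h11] := horizon_nodes (hf _ hk) hn.
  have n1' : (stage n == 1%N) = false by lia.
  split; rewrite ?[collected _ _]/= ?[flow _ _]/= //.
  + by move=> i i0; rewrite /= n1'; apply: h7.
  + by move=> i i0; rewrite stored_level //= n1'; apply: h8.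
  + by move=> i i0; rewrite stored_level //; apply: h9.
- move=> t tT; have ht : (t <= t < minn (t + W) T)%N by lia.
  by have [] := horizon_routing (hf _ tT) ht.
- by move=> n i En i0 /=; rewrite En.
- move=> n i nT i0 /=; case: eqP => n1; last first.
    by apply: (horizon_level_ge0 (hf _ _)) => //; lia.
  by rewrite -greedy_level_root // greedy_level_ge0.
Qed.

Lemma rh_stored_profit sol : (1 < T)%N ->
  (forall k, (1 <= k < T)%N -> rh_solved W sol k) ->
  optimal_profit P = (profit (rh_stored sol))%:E.
Proof.
move=> T1 solved; have fs := rh_stored_feasible solved.
apply: optimal_profit_attained => // s' fs'.
rewrite /profit (horizon_profit_le C0 price0 _ _ _ fs fs') ?leqnn //; last by lia.
have kT : (1 <= T.-1 < T)%N by lia.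
(* As [W] is positive, the last window reaches the leaves, so the stored final levels are the least
   ones. *)
have lT : minn (T.-1 + W) T = T by lia.
have [hu [s hs hl]] : _ /\ _ := rh_subproblem kT (fun j hj => solved j ltac:(lia)).
rewrite lT in hs hl; have hT := solved _ kT; rewrite /rh_solved lT in hT.
have le : (0 < T.-1 <= T)%N by lia.
have hg := optimal_level le (leqnn T) hu hT hs hl.
apply: ler_sum => n /eqP En; apply: ler_wpM2l; first exact/ltW/prob_gt0.
apply: ler_sum => i i0 /=; rewrite ifN; last by lia.
rewrite En hg //; apply: (greedy_level_le _ fs') => //; last by lia.
by move=> m j m1 j0; rewrite greedy_level_root.
Qed.

End RollingHorizon.

Theorem theorem4p1 (R : realType) (N T : nat) (hN : (1 <= N)%N) (hT : (2 <= T)%N)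
    (P : instance R N T) (hC : travel_cost P = 0)
    (hfeas : exists s : decision P, feasible s)
    (hz : optimal_profit P != 0%E)
    (W : nat) (hW : (1 <= W < T - 1)%N)
    (zRH : \bar R) (hRH : rh_value P W zRH) :
  (zRH / optimal_profit P = 1)%E.
Proof.
(* With zero price and no travelling cost every profit is 0, contradicting [hz]. *)
have price0 : 0 < price P.
  rewrite lt_neqAle price_ge0 andbT eq_sym; apply: contraNneq hz => p0.
  have profit0 (s : decision P) : profit s = 0.
    by rewrite /profit /horizon_profit p0 hC !mul0r subr0.
  have [s fs] := hfeas; rewrite (optimal_profit_attained fs) ?profit0 // => s' _.
  by rewrite !profit0.
have /andP[W0 _] := hW.
case: hRH => [sol solved|sol k kT solved infeasible].
  have zE := rh_stored_profit hC price0 W0 hfeas hT solved.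
  by rewrite zE in hz *; rewrite divee.
(* A run cannot break off: the subproblem declared infeasible has a candidate. *)
have [_ [s hs _]] := rh_subproblem hC price0 W0 hfeas kT solved.
by case: (infeasible s).
Qed.
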